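(* Let $f:\mathbb{R}^n\to\mathbb{R}$ be convex and continuously differentiable with $L_1$-Lipschitz gradient, i.e. $\|\nabla f(x)-\nabla f(y)\|\le L_1\|x-y\|$ for all $x,y$. Let the noisy objective be $\tilde f(x;\xi)=f(x)+\nu(x;\xi)$, where for all $x\in\mathbb{R}^n$ the noise $\nu(x;\xi)$ is i.i.d. with $\mathbb{E}_\xi[\nu(x;\xi)]=0$ and variance $\sigma_a^2=\mathrm{Var}(\nu(x;\xi))>0$ (independent of $x$). Let $u\in\mathbb{R}^n$ be a standard Gaussian vector (mean $0$, covariance $I_n$), and let $u,\xi_1,\xi_2$ be independent. For $\mu>0$ define $$\mathcal{E}(\mu)=\left\|\frac{\tilde f(x+\mu u;\xi_1)-\tilde f(x;\xi_2)}{\mu}u-\langle\nabla f(x),u\rangle u\right\|^2 .$$ If $$\mu^*=\left[\frac{8\sigma_a^2 n}{L_1^2(n+6)^3}\right]^{1/4},$$ then for every $x\in\mathbb{R}^n$, $$\mathbb{E}_{u,\xi_1,\xi_2}[\mathcal{E}(\mu^* )]\le \sqrt{2}\,L_1\sigma_a\sqrt{n(n+6)^3}.$$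
   Context: $\|\cdot\|$ is the Euclidean norm and $\langle\cdot,\cdot\rangle$ the Euclidean inner product. The noise values $\nu(\cdot;\xi_1)$ and $\nu(\cdot;\xi_2)$ entering the two evaluations are independent, each with mean $0$ and variance $\sigma_a^2$. *)

(* Defs.v *)
From HB Require Import structures.
From mathcomp Require Import all_boot all_order all_algebra.
From mathcomp Require Import all_classical all_reals all_analysis.
Set Implicit Arguments. Unset Strict Implicit. Unset Printing Implicit Defensive.
Import Order.TTheory GRing.Theory Num.Theory.
Import numFieldNormedType.Exports.
Local Open Scope classical_set_scope.
Local Open Scope ring_scope.

Definition dotv {R : realType} {n : nat} (u v : 'rV[R]_n) : R :=
  \sum_(i < n) u ord0 i * v ord0 i.
Definition enorm {R : realType} {n : nat} (v : 'rV[R]_n) : R :=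
  Num.sqrt (dotv v v).

Definition grad {R : realType} {n : nat} (f : 'rV[R]_n -> R) (x : 'rV[R]_n)
  : 'rV[R]_n := \row_(i < n) ('d f x (delta_mx ord0 i : 'rV[R]_n)).

Definition convex_fun {R : realType} {n : nat} (f : 'rV[R]_n -> R) : Prop :=
  forall (x y : 'rV[R]_n) (a : R), 0 <= a <= 1 ->
    f (a *: x + (1 - a) *: y) <= a * f x + (1 - a) * f y.

(* Identify an n-tuple (carrying the product sigma-algebra) with a row vector. *)
Definition rv_of_tuple {R : realType} {n : nat} (t : n.-tuple R) : 'rV[R]_n :=
  \row_(i < n) tnth t i.

(* Mutual independence of the family (U_1, ..., U_n, Xi1, Xi2) of random
   elements: product rule for preimages of measurable sets (taking some of
   the sets to be the whole space yields the product rule for every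
   subfamily). *)
Definition mutually_indep {d dX : measure_display} {T : measurableType d}
  {X : measurableType dX} {R : realType} (P : probability T R) {n : nat}
  (U : 'I_n -> T -> R) (Xi1 Xi2 : T -> X) : Prop :=
  forall (B : 'I_n -> set R) (C1 C2 : set X),
    (forall i, measurable (B i)) -> measurable C1 -> measurable C2 ->
    P ((\bigcap_(i in [set: 'I_n]) (U i @^-1` B i))
         `&` (Xi1 @^-1` C1) `&` (Xi2 @^-1` C2)) =
    ((\prod_(i < n) P (U i @^-1` B i)) * P (Xi1 @^-1` C1) * P (Xi2 @^-1` C2))%E.

Definition err_quantity {d dX : measure_display} {T : measurableType d}
  {X : measurableType dX} {R : realType} {n : nat}
  (f : 'rV[R]_n -> R) (nu : 'rV[R]_n -> X -> R)
  (U : T -> 'rV[R]_n) (Xi1 Xi2 : T -> X) (x : 'rV[R]_n) (mu : R) (w : T) : R :=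
  let ft := fun (y : 'rV[R]_n) (xi : X) => f y + nu y xi in
  enorm (((ft (x + mu *: U w) (Xi1 w) - ft x (Xi2 w)) / mu) *: U w
         - dotv (grad f x) (U w) *: U w) ^+ 2.

(* Main.v *)
(** Subtracting [<grad f x, u> u] leaves [((D + nu1 - nu2) / mu) u], where
    [D] is the first-order Taylor remainder of [f] at [x] along [mu u], so
    [|D| <= L1 mu^2 |u|^2 / 2]. Conditionally on [u] the two noise terms are
    centered and independent, hence by Tonelli the mean error is
    [E (|u|^2 (D^2 + 2 sigma_a^2)) / mu^2], which is at most
    [L1^2 mu^2 / 4 * E |u|^6 + 2 sigma_a^2 / mu^2 * E |u|^2]. As [|u|^2] is
    chi-squared with [n] degrees of freedom,
    [E |u|^6 = n (n + 2) (n + 4) <= (n + 6)^3], and [mu_star] is the value of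
    [mu] that balances the two terms once [E |u|^6] is replaced by [(n + 6)^3]. *)

Require Import Defs.
From HB Require Import structures.
From mathcomp Require Import all_boot all_order all_algebra.
From mathcomp Require Import all_classical all_reals all_analysis.
From mathcomp Require Import measurable_realfun ring lra.
Set Implicit Arguments.
Unset Strict Implicit.
Unset Printing Implicit Defensive.
Import Order.TTheory GRing.Theory Num.Theory.
Import numFieldNormedType.Exports.
Local Open Scope classical_set_scope.
Local Open Scope ring_scope.

(** * Euclidean geometry and the Taylor remainder *)

Section FirstOrderRemainder.
Context {R : realType}.
Implicit Types (g dg : R -> R) (c M t : R).

Lemma first_order_upper_bound g dg c M :
  (forall t, is_derive t 1 g (dg t)) ->
  (forall t, 0 <= t -> dg t - c <= M * t) ->
  forall t, 0 <= t -> g t - g 0 - c * t <= M / 2 * t ^+ 2.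
Proof.
move=> gE dg_le t t0.
pose h := g - c \*: id - (M / 2) \*: (id ^+ 2 : R -> R).
pose dh (s : R) := dg s - c - M * s.
have h_val s : h s = g s - c * s - M / 2 * s ^+ 2 by [].
have hE (s : R) : is_derive s 1 h (dh s).
  have idE : is_derive s 1 (id ^+ 2 : R -> R) ((2%:R * s ^+ 1) *: (1 : R)).
    exact: is_deriveX.
  have := is_deriveB (is_deriveB (gE s) (is_deriveZ c (is_derive_id s (1 : R))))
    (is_deriveZ (M / 2) idE).
  by move=> /is_derive_eq; apply; rewrite /dh /GRing.scale/= expr1; field.
have h_cont : {within `[0, t], continuous h}.
  apply: continuous_subspaceT => s; apply: differentiable_continuous.
  by apply/derivable1_diffP; have [] := hE s.
have [s s0t] := MVT_segment t0 (fun s _ => hE s) h_cont.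
have : dh s * (t - 0) <= 0.
  by rewrite mulr_le0_ge0 ?subr0// subr_le0 dg_le// (itvP s0t).
by rewrite !h_val => /[swap] <-; rewrite expr0n/=; lra.
Qed.

Lemma first_order_remainder g dg c M :
  (forall t, is_derive t 1 g (dg t)) ->
  (forall t, 0 <= t -> `|dg t - c| <= M * t) ->
  forall t, 0 <= t -> `|g t - g 0 - c * t| <= M / 2 * t ^+ 2.
Proof.
move=> gE dg_le t t0.
have dg_upper s : 0 <= s -> dg s - c <= M * s.
  by move=> /dg_le; rewrite ler_norml => /andP[].
have dg_lower s : 0 <= s -> - dg s - - c <= M * s.
  by move=> /dg_le; rewrite ler_norml => /andP[]; lra.
have upper := first_order_upper_bound gE dg_upper t0.
have /= lower := first_order_upper_bound (fun s => is_deriveN (gE s)) dg_lower t0.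
by rewrite ler_norml upper andbT; move: lower; rewrite !fctE; lra.
Qed.

End FirstOrderRemainder.

Section EuclideanSpace.
Context {R : realType} {n : nat}.
Implicit Types (u v w x : 'rV[R]_n) (f : 'rV[R]_n -> R).

Lemma dotvC u v : dotv u v = dotv v u.
Proof. by apply: eq_bigr => i _; rewrite mulrC. Qed.

Lemma dotvBl u v w : dotv (u - v) w = dotv u w - dotv v w.
Proof. by rewrite /dotv -sumrB; apply: eq_bigr => i _; rewrite !mxE mulrBl. Qed.

Lemma dotvBr u v w : dotv u (v - w) = dotv u v - dotv u w.
Proof. by rewrite ![dotv u _]dotvC dotvBl. Qed.

Lemma dotvZl (a : R) u v : dotv (a *: u) v = a * dotv u v.
Proof. by rewrite /dotv mulr_sumr; apply: eq_bigr => i _; rewrite mxE mulrA. Qed.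

Lemma dotvZr (a : R) u v : dotv u (a *: v) = a * dotv u v.
Proof. by rewrite ![dotv u _]dotvC dotvZl. Qed.

Lemma dotv_dim0 u v : n = 0%N -> dotv u v = 0.
Proof. by move=> n0; move: u v; rewrite n0 => u v; exact: big_ord0. Qed.

Lemma dotv_ge0 v : 0 <= dotv v v.
Proof. by apply: sumr_ge0 => i _; rewrite -expr2 sqr_ge0. Qed.

Lemma dotv_eq0 v : (dotv v v == 0) = (v == 0).
Proof.
apply/idP/eqP => [|->]; last by rewrite /dotv big1// => i _; rewrite mxE mul0r.
rewrite psumr_eq0 => [/allP v0|i _]; last by rewrite -expr2 sqr_ge0.
apply/rowP => i; rewrite mxE; apply/eqP.
by have := v0 i (mem_index_enum i); rewrite mulf_eq0 orbb.
Qed.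

Lemma enorm_ge0 v : 0 <= enorm v.
Proof. exact: sqrtr_ge0. Qed.

Lemma sqr_enorm v : enorm v ^+ 2 = dotv v v.
Proof. by rewrite sqr_sqrtr// dotv_ge0. Qed.

Lemma enormZ (a : R) v : enorm (a *: v) = `|a| * enorm v.
Proof. by rewrite /enorm dotvZl dotvZr mulrA sqrtrM -?expr2 ?sqr_ge0// sqrtr_sqr. Qed.

Lemma dotv_CauchySchwarz u v : `|dotv u v| <= enorm u * enorm v.
Proof.
rewrite -ler_sqr ?nnegrE ?mulr_ge0 ?enorm_ge0//.
rewrite real_normK ?num_real// exprMn !sqr_enorm.
have [->|v_neq0] := eqVneq v 0.
  by rewrite -(scale0r 0) !dotvZr !mul0r mulr0 expr0n.
have v_gt0 : 0 < dotv v v by rewrite lt_def dotv_eq0 v_neq0 dotv_ge0.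
have := dotv_ge0 (dotv v v *: u - dotv u v *: v).
rewrite !(dotvBl, dotvBr, dotvZl, dotvZr) (dotvC v u).
set a := dotv v v; set b := dotv u v; set c := dotv u u.
rewrite [leRHS](_ : _ = a * (c * a - b ^+ 2)); last by ring.
by rewrite pmulr_rge0// subr_ge0.
Qed.

Lemma diff_grad f x v : differentiable f x -> 'd f x v = dotv (grad f x) v.
Proof.
move=> df; rewrite [in LHS](row_sum_delta v) linear_sum; apply: eq_bigr => i _.
by rewrite linearZ/= mxE mulrC.
Qed.

Lemma is_derive_line f x v (t : R) : differentiable f (x + t *: v) ->
  is_derive t 1 (fun s : R => f (x + s *: v)) (dotv (grad f (x + t *: v)) v).
Proof.
move=> df.
have line_diff : is_diff t (fun s : R => x + s *: v) (fun s => s *: v).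
  rewrite (_ : (fun s => _) = cst x + ( *:%R^~ v : R -> 'rV[R]_n))//.
  by rewrite -[X in is_diff _ _ X]add0r; exact: is_diffD.
have comp_diff : differentiable (f \o (fun s : R => x + s *: v)) t.
  exact: differentiable_comp.
apply: DeriveDef; first exact/diff_derivable.
by rewrite deriveE// diff_comp//= -diff_grad// diff_val scale1r.
Qed.

Definition taylor_remainder f x v := f (x + v) - f x - dotv (grad f x) v.

Definition lipschitz_grad f (L : R) :=
  forall x y, enorm (grad f x - grad f y) <= L * enorm (x - y).

Lemma lipschitz_grad_remainder f (L : R) x v :
  (forall y, differentiable f y) -> lipschitz_grad f L ->
  `|taylor_remainder f x v| <= L / 2 * dotv v v.
Proof.
move=> df f_lip.
have := first_order_remainder (c := dotv (grad f x) v) (M := L * dotv v v)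
  (fun t => is_derive_line (df (x + t *: v))) _ ler01.
rewrite scale1r scale0r addr0 expr1n !mulr1 mulrAC; apply => t t0.
rewrite -dotvBl (le_trans (dotv_CauchySchwarz _ _))//.
rewrite (le_trans (ler_wpM2r (enorm_ge0 _) (f_lip _ _)))//.
by rewrite addrAC subrr add0r enormZ ger0_norm// -sqr_enorm; lra.
Qed.

End EuclideanSpace.

(** * Independence *)

Lemma measurable_preimage {d1 d2} {T : measurableType d1} {A : measurableType d2}
    (V : T -> A) (C : set A) :
  measurable_fun setT V -> measurable C -> measurable (V @^-1` C).
Proof. by move=> mV mC; rewrite -[X in measurable X]setTI; exact: mV. Qed.

Definition independent_rv {d d1 d2} {T : measurableType d} {A : measurableType d1}
    {B : measurableType d2} {R : realType} (P : probability T R)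
    (V : T -> A) (W : T -> B) :=
  forall C D, measurable C -> measurable D ->
    P (V @^-1` C `&` W @^-1` D) = (P (V @^-1` C) * P (W @^-1` D))%E.

Definition generating_pi_system {d} {A : measurableType d} (G : set (set A)) :=
  [/\ @measurable _ A = <<s G >>, setI_closed G & G setT].

Lemma measurable_pi_system {d} {A : measurableType d} :
  generating_pi_system (@measurable _ A).
Proof.
split=> //; last by move=> C D; exact: measurableI.
by rewrite sigma_algebra_id//; exact: sigma_algebra_measurable.
Qed.

Lemma rectangles_pi_system {d1 d2} {A : measurableType d1} {B : measurableType d2} :
  generating_pi_system [set C `*` D | C in @measurable _ A & D in @measurable _ B].
Proof.
split; first exact: measurable_prod_measurableType.
- move=> _ _ [C1 mC1 [C2 mC2 <-]] [D1 mD1 [D2 mD2 <-]].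
  exists (C1 `&` D1); first exact: measurableI.
  by exists (C2 `&` D2); [exact: measurableI|rewrite setXI].
- by exists setT => //; exists setT => //; rewrite setXTT.
Qed.

Lemma independent_event_pi_system {d d1} {T : measurableType d}
    {A : measurableType d1} {R : realType} (P : probability T R)
    (G : set (set A)) (V : T -> A) (E : set T) :
  generating_pi_system G -> measurable_fun setT V -> measurable E ->
  (forall C, G C -> P (V @^-1` C `&` E) = (P (V @^-1` C) * P E)%E) ->
  forall C, measurable C -> P (V @^-1` C `&` E) = (P (V @^-1` C) * P E)%E.
Proof.
move=> [G_gen G_setI G_setT] mV mE indepG C mC.
pose rV : {mfun T >-> A} := HB.pack V (isMeasurableFun.Build _ _ _ _ _ mV).
pose PE : {nonneg R} := NngNum (fine_ge0 (measure_ge0 P E)).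
have PEE : PE%:num%:E = P E by rewrite fineK// fin_num_measure.
rewrite muleC -PEE.
apply: (@measure_unique _ _ _ G (fun=> setT) G_gen G_setI _ _
  (pushforward (mrestr P mE) rV) (mscale PE (pushforward P rV))) => //.
- by rewrite bigcup_const.
- by move=> D GD /=; rewrite /mscale/= PEE muleC; exact: indepG.
- by rewrite /= /pushforward /mrestr preimage_setT setTI ltey_eq fin_num_measure.
Qed.

Section IndependenceCriteria.
Context {d d1 d2} {T : measurableType d} {A : measurableType d1}
  {B : measurableType d2} {R : realType} (P : probability T R).
Implicit Types (V : T -> A) (W : T -> B).

Lemma independent_rv_sym V W : independent_rv P V W -> independent_rv P W V.
Proof. by move=> indep C D mC mD; rewrite setIC indep// muleC. Qed.

Lemma independent_rv_comp {d3 d4} {A' : measurableType d3} {B' : measurableType d4}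
    V W (g : A -> A') (h : B -> B') :
  measurable_fun setT g -> measurable_fun setT h ->
  independent_rv P V W -> independent_rv P (g \o V) (h \o W).
Proof.
move=> mg mh indep C D mC mD.
exact: indep (measurable_preimage mg mC) (measurable_preimage mh mD).
Qed.

Lemma independent_rv_pi_system (G : set (set A)) (H : set (set B)) V W :
  generating_pi_system G -> generating_pi_system H ->
  measurable_fun setT V -> measurable_fun setT W ->
  (forall C D, G C -> H D ->
    P (V @^-1` C `&` W @^-1` D) = (P (V @^-1` C) * P (W @^-1` D))%E) ->
  independent_rv P V W.
Proof.
move=> G_pi H_pi mV mW indepGH C D mC mD.
apply: (independent_event_pi_system G_pi) => //; first exact: measurable_preimage.
move=> C' GC'; rewrite setIC muleC; apply: (independent_event_pi_system H_pi) => //.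
  have [G_gen _ _] := G_pi; apply: measurable_preimage => //.
  by rewrite G_gen; exact: sub_sigma_algebra.
by move=> D' HD'; rewrite setIC muleC; exact: indepGH.
Qed.

End IndependenceCriteria.

Lemma ge0_integral_independent {d d1 d2} {T : measurableType d}
    {A : measurableType d1} {B : measurableType d2} {R : realType}
    (P : probability T R) (V : T -> A) (W : T -> B) (h : A * B -> \bar R) :
  measurable_fun setT V -> measurable_fun setT W -> independent_rv P V W ->
  measurable_fun setT h -> (forall z, 0 <= h z)%E ->
  (\int[P]_w h (V w, W w) = \int[P]_w \int[P]_w' h (V w, W w'))%E.
Proof.
move=> mV mW indep mh h0.
have mVW : measurable_fun setT (fun w => (V w, W w)) by exact: measurable_fun_pair.
pose rV : {RV P >-> A} := HB.pack V (isMeasurableFun.Build _ _ _ _ _ mV).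
pose rW : {RV P >-> B} := HB.pack W (isMeasurableFun.Build _ _ _ _ _ mW).
pose rVW : {RV P >-> (A * B)%type} :=
  HB.pack (fun w => (V w, W w)) (isMeasurableFun.Build _ _ _ _ _ mVW).
transitivity (\int[distribution P rV \x distribution P rW]_z h z)%E.
  rewrite -[LHS](@ge0_integral_distribution _ _ _ _ _ _ rVW h)//.
  by apply: eq_measure_integral => C mC _; apply/esym/product_measure_unique.
rewrite fubini_tonelli1// (@ge0_integral_distribution _ _ _ _ _ _ rV)//.
- apply: eq_integral => w _; rewrite /fubini_F/=.
  rewrite (@ge0_integral_distribution _ _ _ _ _ _ rW (fun y => h (V w, y)))//.
  exact: measurableT_comp.
- exact: measurable_fun_fubini_tonelli_F.
- by move=> x; apply: integral_ge0.
Qed.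

Lemma ge0_integralM_independent {d} {T : measurableType d} {R : realType}
    (P : probability T R) (X Y : T -> R) :
  measurable_fun setT X -> measurable_fun setT Y -> independent_rv P X Y ->
  (forall w, 0 <= X w) -> (forall w, 0 <= Y w) ->
  (\int[P]_w (X w * Y w)%:E = \int[P]_w (X w)%:E * \int[P]_w (Y w)%:E)%E.
Proof.
move=> mX mY indep X0 Y0.
pose h (z : R * R) := (`|z.1| * `|z.2|)%:E.
have mh : measurable_fun setT h.
  by apply/measurable_EFinP; apply: measurable_funM; apply: measurableT_comp.
have hE w w' : h (X w, Y w') = ((X w)%:E * (Y w')%:E)%E.
  by rewrite /h/= !ger0_norm// EFinM.
transitivity (\int[P]_w h (X w, Y w))%E.
  by apply: eq_integral => w _; rewrite hE EFinM.
rewrite ge0_integral_independent// => [|z]; last by rewrite lee_fin mulr_ge0.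
have meX : measurable_fun setT (EFin \o X) by exact/measurable_EFinP.
have meY : measurable_fun setT (EFin \o Y) by exact/measurable_EFinP.
have eX0 w : (0 <= (X w)%:E)%E by rewrite lee_fin.
have eY0 w : (0 <= (Y w)%:E)%E by rewrite lee_fin.
transitivity (\int[P]_w ((X w)%:E * \int[P]_w' (Y w')%:E))%E.
  apply: eq_integral => w _; under eq_integral do rewrite hE.
  exact: ge0_integralZl.
by rewrite ge0_integralZr//; exact: integral_ge0.
Qed.

Section TupleBoxes.
Context {d} {A : measurableType d} {n : nat}.

Definition tuple_boxes : set (set (n.-tuple A)) :=
  [set S | exists2 B : 'I_n -> set A, forall i, measurable (B i) &
     S = \bigcap_(i in [set: 'I_n]) (fun t => tnth t i) @^-1` B i].

Let tuple_boxes_generate : @measurable _ (n.-tuple A) = <<s tuple_boxes >>.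
Proof.
apply/seteqP; split.
  apply: smallest_sub; first exact: smallest_sigma_algebra.
  rewrite -bigcup_seq => _ [i _ [B mB <-]]; apply: sub_gen_smallest.
  exists (fun j => if j == i then B else setT) => [j|]; first by case: ifP.
  apply/seteqP; split=> [t [_ Bt] j _ /=|t Bt]; first by case: eqP => // ->.
  by split=> //; have := Bt i Logic.I; rewrite /= eqxx.
apply: smallest_sub; first exact: sigma_algebra_measurable.
move=> _ [B mB ->]; apply: fin_bigcap_measurable => // i _.
by apply: measurable_preimage => //; exact: measurable_tnth.
Qed.

Let tuple_boxes_setI : setI_closed tuple_boxes.
Proof.
move=> _ _ [B mB ->] [C mC ->]; exists (fun i => B i `&` C i) => [i|].
  exact: measurableI.
apply/seteqP; split=> [t [Bt Ct] i _|t BCt]; first by split; [exact: Bt|exact: Ct].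
by split=> i _; have [] := BCt i Logic.I.
Qed.

Lemma tuple_boxes_pi_system : generating_pi_system tuple_boxes.
Proof.
split; [exact: tuple_boxes_generate|exact: tuple_boxes_setI|].
by exists (fun=> setT) => //; apply/seteqP; split.
Qed.

End TupleBoxes.

Lemma measurable_mktuple {d d1} {T : measurableType d} {A : measurableType d1}
    {n : nat} (U : 'I_n -> T -> A) : (forall i, measurable_fun setT (U i)) ->
  measurable_fun setT (fun w => [tuple U i w | i < n]).
Proof.
move=> mU; apply/measurable_fun_tnthP => i.
by apply: eq_measurable_fun (mU i) => w _ /=; rewrite tnth_mktuple.
Qed.

Lemma independent_mktuple {d d1 d2} {T : measurableType d} {A : measurableType d1}
    {B : measurableType d2} {R : realType} (P : probability T R) {n : nat}
    (U : 'I_n -> T -> A) (W : T -> B) (H : set (set B)) :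
  (forall i, measurable_fun setT (U i)) -> measurable_fun setT W ->
  generating_pi_system H ->
  (forall (C : 'I_n -> set A) D, (forall i, measurable (C i)) -> H D ->
    P (\bigcap_(i in [set: 'I_n]) (U i @^-1` C i) `&` W @^-1` D) =
    (P (\bigcap_(i in [set: 'I_n]) (U i @^-1` C i)) * P (W @^-1` D))%E) ->
  independent_rv P (fun w => [tuple U i w | i < n]) W.
Proof.
move=> mU mW H_pi indep_boxes.
apply: (independent_rv_pi_system tuple_boxes_pi_system H_pi) => //.
  exact: measurable_mktuple.
move=> _ D [C mC ->] HD.
have -> : (fun w => [tuple U i w | i < n]) @^-1`
    (\bigcap_(i in [set: 'I_n]) (fun t => tnth t i) @^-1` C i) =
    \bigcap_(i in [set: 'I_n]) (U i @^-1` C i).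
  rewrite preimage_bigcap; apply: eq_bigcapr => i _.
  by apply/seteqP; split=> w /=; rewrite tnth_mktuple.
exact: indep_boxes.
Qed.

Definition mutually_independent_rv {d d1} {T : measurableType d}
    {A : measurableType d1} {R : realType} (P : probability T R) {n : nat}
    (U : 'I_n -> T -> A) :=
  forall C : 'I_n -> set A, (forall i, measurable (C i)) ->
  P (\bigcap_(i in [set: 'I_n]) (U i @^-1` C i)) = (\prod_(i < n) P (U i @^-1` C i))%E.

Lemma bigcap_ord_recl {T : Type} {n : nat} (F : 'I_n.+1 -> set T) :
  \bigcap_(i in [set: 'I_n.+1]) F i =
  F ord0 `&` \bigcap_(i in [set: 'I_n]) F (lift ord0 i).
Proof.
apply/seteqP; split=> [w Fw|w [F0 Fw] i _]; first by split=> [|i _]; exact: Fw.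
by case: (unliftP ord0 i) => [j|] ->; [exact: Fw|].
Qed.

Section MutuallyIndependentRecl.
Context {d d1} {T : measurableType d} {A : measurableType d1} {R : realType}
  (P : probability T R) {n : nat} (U : 'I_n.+1 -> T -> A).
Hypothesis U_indep : mutually_independent_rv P U.

Let probability_bigcap_head (C : 'I_n -> set A) (D : set A) :
  (forall i, measurable (C i)) -> measurable D ->
  P (\bigcap_(i in [set: 'I_n]) (U (lift ord0 i) @^-1` C i) `&` U ord0 @^-1` D) =
  (\prod_(i < n) P (U (lift ord0 i) @^-1` C i) * P (U ord0 @^-1` D))%E.
Proof.
move=> mC mD; pose E i := oapp C D (unlift ord0 i).
have mE i : measurable (E i) by rewrite /E; case: unlift.
have E0 : E ord0 = D by rewrite /E unlift_none.
have Elift i : E (lift ord0 i) = C i by rewrite /E liftK.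
have := U_indep mE; rewrite bigcap_ord_recl big_ord_recl E0.
under eq_bigcapr do rewrite Elift.
by under eq_bigr do rewrite Elift; rewrite setIC muleC.
Qed.

Lemma mutually_independent_behead :
  mutually_independent_rv P (fun i => U (lift ord0 i)).
Proof.
move=> C mC; have := probability_bigcap_head mC measurableT.
by rewrite preimage_setT setIT probability_setT mule1.
Qed.

Lemma independent_behead_head : (forall i, measurable_fun setT (U i)) ->
  independent_rv P (fun w => [tuple U (lift ord0 i) w | i < n]) (U ord0).
Proof.
move=> mU; apply: (independent_mktuple _ (mU ord0) measurable_pi_system) => //.
move=> C D mC mD.
by rewrite probability_bigcap_head// mutually_independent_behead.
Qed.

End MutuallyIndependentRecl.

Section MutuallyIndep.
Context {R : realType} {d dX : measure_display} {T : measurableType d}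
  {X : measurableType dX} (P : probability T R) {n : nat}
  (U : 'I_n -> T -> R) (Xi1 Xi2 : T -> X).
Hypothesis indep : mutually_indep P U Xi1 Xi2.

Lemma mutually_indep_coords : mutually_independent_rv P U.
Proof.
move=> C mC; have := indep mC measurableT measurableT.
by rewrite !preimage_setT !setIT probability_setT !mule1.
Qed.

Lemma mutually_indep_noise : independent_rv P Xi1 Xi2.
Proof.
move=> C D mC mD; have := indep (fun=> measurableT) mC mD.
have -> : \bigcap_(i in [set: 'I_n]) (U i @^-1` setT) = setT by apply/seteqP; split.
by rewrite setTI big1 ?mul1e// => i _; rewrite preimage_setT probability_setT.
Qed.

Lemma mutually_indep_coords_noise :
  (forall i, measurable_fun setT (U i)) ->
  measurable_fun setT Xi1 -> measurable_fun setT Xi2 ->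
  independent_rv P (fun w => [tuple U i w | i < n]) (fun w => (Xi1 w, Xi2 w)).
Proof.
move=> mU mXi1 mXi2; have mXi := measurable_fun_pair mXi1 mXi2.
apply: (independent_mktuple mU mXi rectangles_pi_system).
move=> C _ mC [D1 mD1 [D2 mD2 <-]].
rewrite -[_ @^-1` (D1 `*` D2)]/(Xi1 @^-1` D1 `&` Xi2 @^-1` D2).
by rewrite mutually_indep_noise// setIA indep// mutually_indep_coords// muleA.
Qed.

End MutuallyIndep.

(** * Chi-squared and Gaussian moments *)

(* The value of E[X^k] for X chi-squared with a degrees of freedom. *)
Definition chi2_moment {R : comNzRingType} (a : R) (k : nat) : R :=
  \prod_(j < k) (a + (2 * j)%:R).

Lemma chi2_moment0 {R : comNzRingType} k : chi2_moment (0 : R) k = 0 ^+ k.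
Proof.
case: k => [|k]; first by rewrite /chi2_moment big_ord0.
by rewrite /chi2_moment big_ord_recl muln0 addr0 mul0r exprS mul0r.
Qed.

Lemma chi2_momentS {R : comNzRingType} (a : R) k :
  chi2_moment a k.+1 = chi2_moment a k * (a + (2 * k)%:R).
Proof. exact: big_ord_recr. Qed.

Lemma chi2_momentD {R : comNzRingType} (a b : R) k :
  chi2_moment (a + b) k =
  \sum_(i < k.+1) (chi2_moment a (k - i) * chi2_moment b i) *+ 'C(k, i).
Proof.
pose term k i := chi2_moment a (k - i) * chi2_moment b i.
elim: k => [|k IHk].
  by rewrite big_ord_recl big_ord0 /chi2_moment !big_ord0 mulr1 addr0.
have split_factor (i : 'I_k.+1) : term k i *+ 'C(k, i) * (a + b + (2 * k)%:R) =
    term k.+1 i *+ 'C(k, i) + term k.+1 i.+1 *+ 'C(k, i).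
  have ik : (i <= k)%N by rewrite -ltnS.
  have -> : (2 * k)%:R = (2 * (k - i))%:R + (2 * i)%:R :> R.
    by rewrite -natrD -mulnDr subnK.
  by rewrite /term subSS subSn// !chi2_momentS; ring.
rewrite chi2_momentS IHk mulr_suml (eq_bigr _ (fun i _ => split_factor i)).
rewrite big_split/= [RHS]big_ord_recl [X in X + _]big_ord_recl !bin0 -addrA.
congr (_ + _); rewrite [X in _ + X]big_ord_recr [RHS]big_ord_recr/= !binn addrA.
by congr (_ + _); rewrite -big_split/=; apply: eq_bigr => i _; rewrite -mulrnDr.
Qed.

Lemma chi2_moment_le {R : realDomainType} (a : R) k : 0 <= a ->
  chi2_moment a k <= (a + (2 * k)%:R) ^+ k.
Proof.
move=> a0; have -> : (a + (2 * k)%:R) ^+ k = \prod_(j < k) (a + (2 * k)%:R).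
  by rewrite prodr_const card_ord.
apply: ler_prod => j _; rewrite addr_ge0//= lerD2l ler_nat.
by rewrite leq_mul2l ltnW.
Qed.

Section Chi2Moments.
Context {d} {T : measurableType d} {R : realType} (P : probability T R).

Definition has_chi2_moments (X : T -> R) (a : R) :=
  forall k, (\int[P]_w (X w ^+ k)%:E = (chi2_moment a k)%:E)%E.

Lemma has_chi2_momentsD (X Y : T -> R) (a b : R) :
  measurable_fun setT X -> measurable_fun setT Y -> independent_rv P X Y ->
  (forall w, 0 <= X w) -> (forall w, 0 <= Y w) ->
  has_chi2_moments X a -> has_chi2_moments Y b ->
  has_chi2_moments (fun w => X w + Y w) (a + b).
Proof.
move=> mX mY indep X0 Y0 Xa Yb k.
pose term i w := X w ^+ (k - i) * Y w ^+ i.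
have mterm i : measurable_fun setT (EFin \o term i).
  by apply/measurable_EFinP; apply: measurable_funM; exact: measurable_funX.
have term0 i w : (0 <= (term i w)%:E)%E by rewrite lee_fin mulr_ge0// exprn_ge0.
have term_int i : (\int[P]_w (term i w)%:E =
    (chi2_moment a (k - i) * chi2_moment b i)%:E)%E.
  rewrite ge0_integralM_independent ?Xa ?Yb//; first exact: measurable_funX.
  - exact: measurable_funX.
  - exact: (independent_rv_comp (@exprn_measurable R setT (k - i))
      (@exprn_measurable R setT i) indep).
  - by move=> w; rewrite exprn_ge0.
  - by move=> w; rewrite exprn_ge0.
transitivity (\int[P]_w \sum_(i < k.+1) ('C(k, i)%:R%:E * (term i w)%:E))%E.
  apply: eq_integral => w _; rewrite exprDn -sumEFin.
  by apply: eq_bigr => i _; rewrite -EFinM mulr_natl.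
rewrite ge0_integral_sum//; last 2 first.
- by move=> i; apply: measurable_funeM; exact: mterm.
- by move=> i w _; rewrite -EFinM lee_fin mulr_ge0// -lee_fin.
rewrite chi2_momentD -sumEFin; apply: eq_bigr => i _.
rewrite ge0_integralZl ?lee_fin//; last exact: mterm.
by rewrite term_int -EFinM mulr_natl.
Qed.

Lemma has_chi2_moments_sum n (U : 'I_n -> T -> R) :
  (forall i, measurable_fun setT (U i)) -> mutually_independent_rv P U ->
  (forall i, has_chi2_moments (fun w => U i w ^+ 2) 1) ->
  has_chi2_moments (fun w => \sum_(i < n) U i w ^+ 2) n%:R.
Proof.
elim: n U => [|n IHn] U mU indep U1 k.
  under eq_integral do rewrite big_ord0.
  by rewrite integral_cst//= probability_setT mule1 chi2_moment0.
under eq_integral do rewrite big_ord_recl.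
rewrite -nat1r; move: k; apply: has_chi2_momentsD => //.
- exact: measurable_funX.
- by apply: measurable_sum => i; exact: measurable_funX.
- apply: independent_rv_sym.
  pose sum_sqr (t : n.-tuple R) := \sum_(i < n) tnth t i ^+ 2.
  have msum_sqr : measurable_fun setT sum_sqr.
    by apply: measurable_sum => i; apply: measurable_funX; exact: measurable_tnth.
  have := independent_rv_comp msum_sqr (@exprn_measurable R setT 2)
    (independent_behead_head indep mU).
  congr independent_rv; apply/funext => w.
  by apply: eq_bigr => i _; rewrite tnth_mktuple.
- by move=> w; exact: sqr_ge0.
- by move=> w; apply: sumr_ge0 => i _; exact: sqr_ge0.
- exact: IHn (fun i => mU _) (mutually_independent_behead indep) (fun i => U1 _).
Qed.

End Chi2Moments.

Lemma cvg_exprn_expRN {R : realType} k : x ^+ k * expR (- x) @[x --> +oo%R] --> (0 : R).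
Proof.
apply: (@squeeze_cvgr _ _ _ _ (cst 0) (fun x : R => k.+1`!%:R * x^-1)); last 2 first.
- exact: cvg_cst.
- rewrite -[0](mulr0 k.+1`!%:R); apply: cvgMr.
  by apply/gtr0_cvgV0; [near=> x; near: x; exact: nbhs_pinfty_gt|exact: cvg_id].
near=> x; have x0 : 0 < x by near: x; exact: nbhs_pinfty_gt.
rewrite mulr_ge0 ?expR_ge0 ?exprn_ge0 ?(ltW x0)//= expRN.
rewrite ler_pdivrMr ?expR_gt0// mulrAC ler_pdivlMr// -exprSr.
rewrite -ler_pdivrMl ?ltr0n ?fact_gt0// mulrC.
by apply: le_trans (expR_ge1Dxn k (ltW x0)); rewrite lerDr.
Unshelve. all: by end_near. Qed.

Lemma integration_by_parts_is_derive {R : realType} (F G f g : R -> R) (a b : R) :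
  a < b ->
  (forall x : R, is_derive x 1 F (f x)) -> (forall x : R, is_derive x 1 G (g x)) ->
  continuous f -> continuous g ->
  (\int[lebesgue_measure]_(x in `[a, b]) (F x * g x)%:E =
   (F b * G b - F a * G a)%:E - \int[lebesgue_measure]_(x in `[a, b]) (f x * G x)%:E)%E.
Proof.
move=> ab FE GE cf cg.
have LRcontinuous (h dh : R -> R) : (forall x : R, is_derive x 1 h (dh x)) ->
    derivable_oo_LRcontinuous h a b.
  move=> hE; have ch : continuous h.
    by move=> x; apply/differentiable_continuous/derivable1_diffP; have [] := hE x.
  split; first by move=> x _; have [] := hE x.
  - exact/cvg_at_right_filter/ch.
  - exact/cvg_at_left_filter/ch.
apply: integration_by_parts => //.
- exact: continuous_subspaceT.
- exact: LRcontinuous FE.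
- by move=> x _; rewrite derive1E; have [] := FE x.
- exact: continuous_subspaceT.
- exact: LRcontinuous GE.
- by move=> x _; rewrite derive1E; have [] := GE x.
Qed.

Section StandardNormalMoments.
Context {R : realType}.
Local Notation mu := (@lebesgue_measure R).
Local Notation phi := (@normal_pdf R 0 1).

Lemma normal_pdf01E x : phi x = normal_peak 1 * expR (- (x ^+ 2 / 2)).
Proof.
rewrite normal_pdfE ?oner_neq0// /normal_fun subr0 expr1n mulNr.
by rewrite -[X in _ / X]/(2%:R).
Qed.

Lemma is_derive_normal_pdf01 (x : R) : is_derive x 1 phi (- x * phi x).
Proof.
have -> : phi = normal_peak 1 \*: (expR \o ((- 2^-1) \*: (id ^+ 2 : R -> R))).
  apply/funext => y; rewrite normal_pdf01E /= !fctE /GRing.scale/=.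
  by rewrite mulNr [y ^+ 2 / 2]mulrC.
have sqr_derive : is_derive x 1 (id ^+ 2 : R -> R) ((2%:R * x ^+ 1) *: (1 : R)).
  exact: is_deriveX.
have := is_deriveZ (normal_peak 1)
  (is_derive1_comp (is_derive_expR _) (is_deriveZ (- 2^-1) sqr_derive)).
move=> /is_derive_eq; apply; rewrite /= /GRing.scale/= expr1.
by move: (expR _) (normal_peak _) => a b; field.
Qed.

Lemma cvg_exprn_normal_pdf01 k : x ^+ k * phi x @[x --> +oo%R] --> (0 : R).
Proof.
apply: (@squeeze_cvgr _ _ _ _ (cst 0)
  (fun x : R => normal_peak 1 * (x ^+ k * expR (- x)))); last 2 first.
- exact: cvg_cst.
- by rewrite -[0](mulr0 (normal_peak 1)); apply: cvgMr; exact: cvg_exprn_expRN.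
near=> x; have x2 : 2 <= x by near: x; exact: nbhs_pinfty_ge.
have x0 : 0 <= x by exact: le_trans x2.
rewrite mulr_ge0 ?normal_pdf_ge0 ?exprn_ge0//= normal_pdf01E mulrCA.
rewrite !ler_wpM2l ?normal_peak_ge0 ?exprn_ge0// ler_expR lerN2.
by rewrite ler_pdivlMr// expr2 ler_wpM2l.
Unshelve. all: by end_near. Qed.

Let even_moment_density k (x : R) := x ^+ (2 * k) * phi x.

Let even_moment_density_ge0 k x : (0 <= (even_moment_density k x)%:E)%E.
Proof. by rewrite lee_fin mulr_ge0 ?normal_pdf_ge0// exprM exprn_ge0 ?sqr_ge0. Qed.

Let continuous_exprn_pdf k : continuous (fun x : R => x ^+ k * phi x).
Proof.
move=> x; apply: cvgM; first exact: exprn_continuous.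
by apply: continuous_normal_pdf; rewrite oner_neq0.
Qed.

Let measurable_even_moment_density k :
  measurable_fun setT (EFin \o even_moment_density k).
Proof.
apply/measurable_EFinP; apply: continuous_measurable_fun.
exact: continuous_exprn_pdf.
Qed.

Lemma integral_normal_moment_itv k (a : R) : 0 < a ->
  (\int[mu]_(x in `[(- a)%R, a]) (x ^+ (2 * k.+1) * phi x)%:E =
   (- (2 * (a ^+ (2 * k).+1 * phi a)))%:E +
   (2 * k).+1%:R%:E * \int[mu]_(x in `[(- a)%R, a]) (x ^+ (2 * k) * phi x)%:E)%E.
Proof.
move=> a0; have aa : - a < a by rewrite gtrN.
pose F : R -> R := id ^+ (2 * k).+1; pose dF (x : R) := (2 * k).+1%:R * x ^+ (2 * k).
pose G (x : R) := - phi x; pose dG (x : R) := x ^+ 1 * phi x.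
have FE (x : R) : is_derive x 1 F (dF x).
  have idE : is_derive x 1 F (((2 * k).+1%:R * x ^+ (2 * k)) *: (1 : R)).
    exact: is_deriveX.
  by apply: is_derive_eq idE _; rewrite /GRing.scale/= mulr1.
have GE (x : R) : is_derive x 1 G (dG x).
  by have := is_deriveN (is_derive_normal_pdf01 x); rewrite mulNr opprK /dG expr1.
have dFc : continuous dF.
  by move=> x; apply: cvgM; [exact: cvg_cst|exact: exprn_continuous].
have parts := integration_by_parts_is_derive aa FE GE dFc (@continuous_exprn_pdf 1).
transitivity (\int[mu]_(x in `[(- a)%R, a]) (F x * dG x)%:E)%E.
  by apply: eq_integral => x _; rewrite /F /dG fctE mulrA -exprD addn1 mulnS.
rewrite parts; congr (_ + _)%E; last first.
  under eq_integral do rewrite mulrN EFinN -mulrA EFinM.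
  rewrite integral_ge0N => [|x _]; last first.
    by apply: mule_ge0; [rewrite lee_fin|exact: even_moment_density_ge0].
  rewrite oppeK ge0_integralZl// => [|x _]; last exact: even_moment_density_ge0.
  by apply: measurable_funTS; exact: measurable_even_moment_density.
have F_odd : F (- a) = - F a by rewrite /F !fctE exprNn -signr_odd/= oddM mulN1r.
have G_even : G (- a) = G a by rewrite /G !normal_pdf01E sqrrN.
by congr EFin; rewrite F_odd G_even /F /G fctE; ring.
Qed.

Lemma ge0_integral_symmetric_itv_cvg (f : R -> \bar R) :
  measurable_fun setT f -> (forall x, 0 <= f x)%E ->
  (\int[mu]_(x in `[(- n%:R)%R, n%:R]) f x @[n --> \oo] --> \int[mu]_x f x)%E.
Proof.
move=> mf f0; pose A (n : nat) := `[- n%:R : R, n%:R]%classic.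
have -> : setT = \bigcup_n A n.
  apply/esym/seteqP; split=> // x _; exists (Num.truncn `|x|).+1 => //.
  by rewrite /A /= in_itv/= -ler_norml ltW// truncnS_gt.
apply: ge0_nondecreasing_set_cvg_integral => //.
- move=> i j ij; apply/subsetPset => x; rewrite /A /= !in_itv/= -!ler_norml.
  by move=> /le_trans; apply; rewrite ler_nat.
- by move=> n; exact: measurable_funTS.
Qed.

Lemma normal_even_moment_rec k :
  (\int[mu]_x (x ^+ (2 * k.+1) * phi x)%:E =
   (2 * k).+1%:R%:E * \int[mu]_x (x ^+ (2 * k) * phi x)%:E)%E.
Proof.
have lhs_cvg := ge0_integral_symmetric_itv_cvg
  (measurable_even_moment_density k.+1) (even_moment_density_ge0 k.+1).
have rhs_cvg := ge0_integral_symmetric_itv_cvg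
  (measurable_even_moment_density k) (even_moment_density_ge0 k).
have boundary_cvg :
    (- (2 * (n%:R ^+ (2 * k).+1 * phi n%:R)))%:E @[n --> \oo] --> (0 : \bar R).
  apply: cvg_EFin; first exact: nearW.
  rewrite -[X in _ --> X]oppr0 -[X in _ --> - X](mulr0 2); apply: cvgN; apply: cvgMr.
  exact: (cvg_comp _ _ cvgr_idn (@cvg_exprn_normal_pdf01 (2 * k).+1)).
have sum_cvg := cvgeD (@fin_num_adde_defr _ 0%E _ isT) boundary_cvg
  (cvgeZl (isT : (2 * k).+1%:R%:E \is a fin_num) rhs_cvg).
rewrite add0e in sum_cvg; rewrite -[LHS](cvg_lim _ lhs_cvg)//; apply: cvg_lim => //.
apply: cvg_trans (sum_cvg _); apply: near_eq_cvg; near=> n.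
rewrite /even_moment_density integral_normal_moment_itv// ltr0n.
by near: n; exists 1%N.
Unshelve. all: by end_near. Qed.

Lemma normal_even_moment k :
  (\int[mu]_x (x ^+ (2 * k) * phi x)%:E = (chi2_moment 1 k)%:E)%E.
Proof.
elim: k => [|k IHk]; last first.
  by rewrite normal_even_moment_rec IHk chi2_momentS nat1r mulrC.
rewrite /chi2_moment big_ord0 -[RHS](@integral_normal_pdf R 0 1).
by apply: eq_integral => x _; rewrite muln0 expr0 mul1r.
Qed.

End StandardNormalMoments.

Lemma ge0_integral_normal_prob {R : realType} (m s : R) (f : R -> \bar R) :
  measurable_fun setT f -> (forall x, 0 <= f x)%E ->
  (\int[normal_prob m s]_x f x =
   \int[lebesgue_measure]_x (f x * (normal_pdf m s x)%:E))%E.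
Proof.
move=> mf f0; have dom := normal_prob_dominates m s.
have mpdf : measurable_fun setT (fun x => (normal_pdf m s x)%:E).
  by apply/measurable_EFinP; exact: measurable_normal_pdf.
have RN_integrable := Radon_Nikodym_SigmaFinite.f_integrable dom.
have mRN := measurable_int _ RN_integrable.
rewrite -(Radon_Nikodym_SigmaFinite.change_of_variables dom)//.
apply: ae_eq_integral => //; [exact: emeasurable_funM|exact: emeasurable_funM|].
apply: ae_eqe_mul2l; apply: integral_ae_eq => // E _ mE.
by rewrite -(Radon_Nikodym_SigmaFinite.f_integral dom).
Qed.

Definition standard_normal_rv {d} {T : measurableType d} {R : realType}
    (P : probability T R) (y : T -> R) :=
  forall B : set R, measurable B -> P (y @^-1` B) = normal_prob 0 1 B.

Lemma standard_normal_has_chi2_moments {d} {T : measurableType d} {R : realType}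
    (P : probability T R) (y : T -> R) :
  measurable_fun setT y -> standard_normal_rv P y ->
  has_chi2_moments P (fun w => y w ^+ 2) 1.
Proof.
move=> my y_law k.
have my_borel : @measurable_fun _ _ T (measurableTypeR R) setT y by exact: my.
pose ry : {RV P >-> measurableTypeR R} :=
  HB.pack y (isMeasurableFun.Build _ _ _ _ _ my_borel).
pose pow (x : R) := (x ^+ (2 * k))%:E.
have mpow : measurable_fun setT pow.
  by apply/measurable_EFinP; exact: measurable_funX.
have pow0 x : (0 <= pow x)%E by rewrite lee_fin exprM exprn_ge0 ?sqr_ge0.
have -> : (\int[P]_w ((y w ^+ 2) ^+ k)%:E = \int[P]_w pow (ry w))%E.
  by apply: eq_integral => w _; rewrite /pow/= exprM.
rewrite -[LHS](@ge0_integral_distribution _ _ _ _ _ _ ry pow)// -normal_even_moment.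
under [RHS]eq_integral do rewrite EFinM -/(pow _).
rewrite -ge0_integral_normal_prob//.
by apply: eq_measure_integral => B mB _; exact: y_law.
Qed.

(** * Measurability of vector-valued maps *)

Section MeasurableVectors.
Context {d} {T : measurableType d} {R : realType} {n : nat}.
Implicit Types (U V : T -> 'rV[R]_n).

Definition measurable_coords V := forall i, measurable_fun setT (fun w => V w ord0 i).

Lemma measurable_coordsZ (m : R) V :
  measurable_coords V -> measurable_coords (fun w => m *: V w).
Proof.
move=> mV i; apply: (eq_measurable_fun (fun w => m * V w ord0 i)).
  by move=> w _; rewrite mxE.
exact: measurable_funM.
Qed.

Lemma measurable_coordsDl (x : 'rV[R]_n) V :
  measurable_coords V -> measurable_coords (fun w => x + V w).
Proof.
move=> mV i; apply: (eq_measurable_fun (fun w => x ord0 i + V w ord0 i)).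
  by move=> w _; rewrite mxE.
exact: measurable_funD.
Qed.

Lemma measurable_dotv U V :
  measurable_coords U -> measurable_coords V ->
  measurable_fun setT (fun w => dotv (U w) (V w)).
Proof. by move=> mU mV; apply: measurable_sum => i; exact: measurable_funM. Qed.

Lemma measurable_countable_comp {I : countType} {d'} {Y : measurableType d'}
    (g : T -> I) (h : I -> Y) :
  (forall i, measurable (g @^-1` [set i])) -> measurable_fun setT (h \o g).
Proof.
move=> mg _ B _; rewrite setTI.
have -> : (h \o g) @^-1` B = \bigcup_(i in h @^-1` B) (g @^-1` [set i]).
  by apply/seteqP; split=> [w Bw|w [i hi /= ->]//]; exists (g w).
rewrite bigcup_mkcond; apply: countable_bigcupT_measurable => // i.
by case: ifP.
Qed.

Lemma measurable_preimage_floor (g : T -> R) (z : int) :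
  measurable_fun setT g -> measurable ((Num.floor \o g) @^-1` [set z]).
Proof.
move=> mg; have -> : (Num.floor \o g) @^-1` [set z] =
    g @^-1` `[z%:~R, (z + 1)%:~R[%classic.
  apply/seteqP; split=> w /=; rewrite in_itv/=; last exact: floor_def.
  by move=> <-; exact: floor_itv.
exact: measurable_preimage.
Qed.

End MeasurableVectors.

Lemma cvg_rV {R : realType} {n : nat} (u : nat -> 'rV[R]_n) (v : 'rV[R]_n) :
  (forall i, u k ord0 i @[k --> \oo] --> v ord0 i) -> u k @[k --> \oo] --> v.
Proof.
move=> uv; apply/cvg_ballP => e e0.
have uv_near : \forall k \near \oo, forall i, ball (v ord0 i) e (u k ord0 i).
  by apply: filter_forall => i; have /cvg_ballP := uv i; exact.
by near=> k; split=> // i; rewrite (ord1 i); near: k.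
Unshelve. all: by end_near. Qed.

Lemma cvg_floor_grid {R : realType} (x : R) :
  (Num.floor (k.+1%:R * x))%:~R / k.+1%:R @[k --> \oo] --> x.
Proof.
apply/cvgrPdist_lt => e e0; near=> k.
have k0 : (0 : R) < k.+1%:R by rewrite ltr0n.
have /andP[floor_le floor_gt] := floor_itv (k.+1%:R * x).
have -> : x - (Num.floor (k.+1%:R * x))%:~R / k.+1%:R =
    (k.+1%:R * x - (Num.floor (k.+1%:R * x))%:~R) / k.+1%:R.
  by field; rewrite gt_eqF.
rewrite ger0_norm ?divr_ge0 ?subr_ge0 ?(ltW k0)//.
apply: (@lt_trans _ _ k.+1%:R^-1); last first.
  by near: k; exact: near_infty_natSinv_lt (PosNum e0).
by rewrite -[ltRHS]mul1r ltr_pM2r ?invr_gt0// ltrBlDl -intrD1.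
Unshelve. all: by end_near. Qed.

(* [f \o V] is the pointwise limit of [f] composed with [V] rounded down to the
   grid of step [1 / (k + 1)], and the rounded map takes countably many values. *)
Lemma measurable_continuous_rV {d} {T : measurableType d} {R : realType} {n : nat}
    (f : 'rV[R]_n -> R) (V : T -> 'rV[R]_n) :
  continuous f -> measurable_coords V -> measurable_fun setT (f \o V).
Proof.
move=> cf mV.
pose cell k (w : T) : {ffun 'I_n -> int} :=
  [ffun i => Num.floor (k.+1%:R * V w ord0 i)].
pose corner k (c : {ffun 'I_n -> int}) : 'rV[R]_n := \row_i ((c i)%:~R / k.+1%:R).
apply: (@measurable_fun_cvg _ _ _ _ (fun k w => f (corner k (cell k w)))).
  move=> k.
  apply: (@measurable_countable_comp _ _ _ _ _ (cell k) (f \o corner k)) => c.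
  have -> : cell k @^-1` [set c] = \bigcap_(i in [set: 'I_n])
      ((Num.floor \o (fun w => k.+1%:R * V w ord0 i)) @^-1` [set c i]).
    apply/seteqP; split=> [w <- i _|w cw]; first by rewrite /cell /= ffunE.
    by apply/ffunP => i; rewrite ffunE; exact: cw.
  apply: fin_bigcap_measurable => // i _; apply: measurable_preimage_floor.
  exact: (measurable_funM (measurable_cst _) (mV i)).
move=> w _; apply: continuous_cvg; first exact: cf.
apply: cvg_rV => i; under eq_fun do rewrite mxE ffunE.
exact: cvg_floor_grid.
Qed.

Section TuplesAsVectors.
Context {R : realType} {n : nat}.

Definition tuple_of_rv (v : 'rV[R]_n) : n.-tuple R := [tuple v ord0 i | i < n].

Lemma tuple_of_rvK : cancel tuple_of_rv rv_of_tuple.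
Proof. by move=> v; apply/rowP => i; rewrite mxE tnth_mktuple. Qed.

Lemma measurable_coords_rv_of_tuple : measurable_coords (@rv_of_tuple R n).
Proof.
move=> i; apply: (eq_measurable_fun (fun t => tnth t i)); last exact: measurable_tnth.
by move=> t _; rewrite mxE.
Qed.

Lemma measurable_noise {d dX} {T : measurableType d} {X : measurableType dX}
    (nu : 'rV[R]_n -> X -> R) (V : T -> 'rV[R]_n) (W : T -> X) :
  measurable_fun setT (fun p : n.-tuple R * X => nu (rv_of_tuple p.1) p.2) ->
  measurable_coords V -> measurable_fun setT W ->
  measurable_fun setT (fun w => nu (V w) (W w)).
Proof.
move=> mnu mV mW.
have mVW : measurable_fun setT (fun w => (tuple_of_rv (V w), W w)).
  by apply: measurable_fun_pair => //; exact: measurable_mktuple.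
have := measurableT_comp mnu mVW.
by apply: eq_measurable_fun => w _ /=; rewrite tuple_of_rvK.
Qed.

Lemma measurable_taylor_remainder {d} {T : measurableType d}
    (f : 'rV[R]_n -> R) (x : 'rV[R]_n) (V : T -> 'rV[R]_n) :
  (forall y, differentiable f y) -> measurable_coords V ->
  measurable_fun setT (fun w => taylor_remainder f x (V w)).
Proof.
move=> df mV; apply: measurable_funB; last first.
  by apply: measurable_dotv => // i; exact: measurable_cst.
apply: measurable_funB => //.
apply: (measurable_continuous_rV _ (measurable_coordsDl x mV)) => y.
exact: differentiable_continuous.
Qed.

End TuplesAsVectors.

(** * Mean error of the noisy forward difference *)

Definition centered_noise {d} {T : measurableType d} {R : realType}
    (P : probability T R) (v : R) (N : T -> R) :=
  P.-integrable setT (EFin \o N) /\ ('E_P[N] = 0)%E /\ ('V_P[N] = v%:E)%E.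

Section CenteredNoise.
Context {d} {T : measurableType d} {R : realType} (P : probability T R).

Lemma measurable_centered_noise (v : R) (N : T -> R) :
  centered_noise P v N -> measurable_fun setT N.
Proof. by move=> [iN _]; apply/measurable_EFinP; exact: measurable_int iN. Qed.

Lemma centered_noise_ge0 (v : R) (N : T -> R) : centered_noise P v N -> 0 <= v.
Proof. by move=> [_ [_ VN]]; rewrite -lee_fin -VN variance_ge0. Qed.

Lemma integral_sqrD_centered (c v : R) (N : T -> R) :
  centered_noise P v N ->
  (\int[P]_w ((c + N w) ^+ 2)%:E = (c ^+ 2 + v)%:E)%E.
Proof.
move=> noiseN; have [iN [EN VN]] := noiseN; have mN := measurable_centered_noise noiseN.
have second_moment : (\int[P]_w (N w ^+ 2)%:E = v%:E)%E.
  rewrite -VN /variance covariance.unlock EN expectation.unlock.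
  by apply: eq_integral => w _ /=; rewrite !fctE/= subr0 expr2.
have first_moment : (\int[P]_w (N w)%:E = 0)%E by rewrite -EN expectation.unlock.
have iN2 : P.-integrable setT (fun w => (N w ^+ 2)%:E).
  apply/integrableP; split; first by apply/measurable_EFinP; exact: measurable_funX.
  under eq_integral do rewrite gee0_abs ?lee_fin ?sqr_ge0//.
  by rewrite second_moment ltry.
have ic : P.-integrable setT (fun w => (c ^+ 2)%:E).
  exact: finite_measure_integrable_cst.
have iNc : P.-integrable setT (fun w => ((2 * c)%:E * (N w)%:E)%E).
  exact: integrableZl.
transitivity (\int[P]_w ((c ^+ 2)%:E + (2 * c)%:E * (N w)%:E + (N w ^+ 2)%:E))%E.
  by apply: eq_integral => w _; rewrite -EFinM -!EFinD; congr EFin; ring.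
rewrite integralD//; last exact: integrableD.
rewrite integralD// integralZl// first_moment mule0 adde0 second_moment.
by rewrite integral_cst//= probability_setT mule1.
Qed.

Lemma integral_sqr_noise_difference (c v1 v2 : R) (N1 N2 : T -> R) :
  independent_rv P N1 N2 -> centered_noise P v1 N1 -> centered_noise P v2 N2 ->
  (\int[P]_w ((c + N1 w - N2 w) ^+ 2)%:E = (c ^+ 2 + (v1 + v2))%:E)%E.
Proof.
move=> indep noise1 noise2.
have mN1 := measurable_centered_noise noise1.
have mN2 := measurable_centered_noise noise2.
pose h (z : R * R) := ((c + z.1 - z.2) ^+ 2)%:E.
have mh : measurable_fun setT h.
  apply/measurable_EFinP; apply: measurable_funX; apply: measurable_funB => //.
  by apply: measurable_funD.
transitivity (\int[P]_w \int[P]_w' h (N1 w, N2 w'))%E.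
  by rewrite -ge0_integral_independent// => z; rewrite lee_fin sqr_ge0.
have integrate_N2 w : (\int[P]_w' h (N1 w, N2 w') = ((c + N1 w) ^+ 2)%:E + v2%:E)%E.
  rewrite -EFinD -sqrrN -(integral_sqrD_centered _ noise2).
  by apply: eq_integral => w' _; rewrite /h/= -sqrrN opprB addrC.
under eq_integral do rewrite integrate_N2.
have v2_ge0 : (0 <= v2%:E)%E by rewrite lee_fin (centered_noise_ge0 noise2).
rewrite ge0_integralD//; last 2 first.
- by move=> w _; rewrite lee_fin sqr_ge0.
- by apply/measurable_EFinP; apply: measurable_funX; exact: measurable_funD.
rewrite (integral_sqrD_centered _ noise1) integral_cst//= probability_setT mule1.
by rewrite addrA.
Qed.

End CenteredNoise.

Lemma integral_weighted_sqr_noise {d dA dX} {T : measurableType d}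
    {A : measurableType dA} {X : measurableType dX} {R : realType}
    (P : probability T R) (V : T -> A) (Xi1 Xi2 : T -> X)
    (weight drift : A -> R) (N1 N2 : A -> X -> R) (v1 v2 : R) :
  measurable_fun setT V -> measurable_fun setT Xi1 -> measurable_fun setT Xi2 ->
  independent_rv P V (fun w => (Xi1 w, Xi2 w)) -> independent_rv P Xi1 Xi2 ->
  measurable_fun setT weight -> (forall a, 0 <= weight a) ->
  measurable_fun setT drift ->
  measurable_fun setT (fun p => N1 p.1 p.2) ->
  measurable_fun setT (fun p => N2 p.1 p.2) ->
  (forall a, centered_noise P v1 (N1 a \o Xi1)) ->
  (forall a, centered_noise P v2 (N2 a \o Xi2)) ->
  (\int[P]_w (weight (V w) *
     (drift (V w) + N1 (V w) (Xi1 w) - N2 (V w) (Xi2 w)) ^+ 2)%:E =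
   \int[P]_w (weight (V w) * (drift (V w) ^+ 2 + (v1 + v2)))%:E)%E.
Proof.
move=> mV mXi1 mXi2 indepV indepXi mweight weight0 mdrift mN1 mN2 noise1 noise2.
pose sqr_noise (p : A * (X * X)) :=
  (drift p.1 + N1 p.1 p.2.1 - N2 p.1 p.2.2) ^+ 2.
have mproj1 : measurable_fun setT (fun p : A * (X * X) => (p.1, p.2.1)).
  by apply: measurable_fun_pair => //; exact: measurableT_comp.
have mproj2 : measurable_fun setT (fun p : A * (X * X) => (p.1, p.2.2)).
  by apply: measurable_fun_pair => //; exact: measurableT_comp.
have msqr_noise : measurable_fun setT sqr_noise.
  apply: measurable_funX; apply: measurable_funB; last first.
    exact: (measurableT_comp mN2 mproj2).
  apply: measurable_funD; first exact: measurableT_comp.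
  exact: (measurableT_comp mN1 mproj1).
have mXi : measurable_fun setT (fun w => (Xi1 w, Xi2 w)) by exact: measurable_fun_pair.
pose h (p : A * (X * X)) := ((weight p.1)%:E * (sqr_noise p)%:E)%E.
have mh : measurable_fun setT h.
  by apply: emeasurable_funM; apply/measurable_EFinP => //; exact: measurableT_comp.
have h0 p : (0 <= h p)%E by rewrite mule_ge0// lee_fin// sqr_ge0.
transitivity (\int[P]_w \int[P]_w'
    ((weight (V w))%:E * (sqr_noise (V w, (Xi1 w', Xi2 w')))%:E))%E.
  exact: (ge0_integral_independent mV mXi indepV mh h0).
apply: eq_integral => w _.
rewrite ge0_integralZl ?lee_fin//; last 2 first.
- apply/measurable_EFinP.
  exact: (measurableT_comp msqr_noise (measurableT_comp (pair1_measurable (V w)) mXi)).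
- by move=> w' _; rewrite lee_fin sqr_ge0.
rewrite EFinM; congr (_ * _)%E.
have := integral_sqr_noise_difference (drift (V w)) _ (noise1 (V w)) (noise2 (V w)).
apply.
apply: independent_rv_comp indepXi.
- exact: (measurableT_comp mN1 (pair1_measurable (V w))).
- exact: (measurableT_comp mN2 (pair1_measurable (V w))).
Qed.

Lemma ge0_integral_lincomb {d} {T : measurableType d} {R : realType}
    (mu : {measure set T -> \bar R}) (a b : R) (g h : T -> R) :
  0 <= a -> 0 <= b -> measurable_fun setT g -> measurable_fun setT h ->
  (forall w, 0 <= g w) -> (forall w, 0 <= h w) ->
  (\int[mu]_w (a * g w + b * h w)%:E =
   a%:E * \int[mu]_w (g w)%:E + b%:E * \int[mu]_w (h w)%:E)%E.
Proof.
move=> a0 b0 mg mh g0 h0.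
have mge : measurable_fun setT (EFin \o g) by exact/measurable_EFinP.
have mhe : measurable_fun setT (EFin \o h) by exact/measurable_EFinP.
have ge0 w : (0 <= (g w)%:E)%E by rewrite lee_fin.
have he0 w : (0 <= (h w)%:E)%E by rewrite lee_fin.
under eq_integral do rewrite EFinD !EFinM.
rewrite ge0_integralD ?ge0_integralZl//.
- by move=> w _; rewrite mule_ge0.
- exact: measurable_funeM.
- by move=> w _; rewrite mule_ge0.
- exact: measurable_funeM.
Qed.

Section ForwardDifferenceError.
Context {R : realType} {n : nat} (f : 'rV[R]_n -> R) (L m : R).
Hypothesis df : forall y : 'rV[R]_n, differentiable f y.
Hypothesis f_lip : lipschitz_grad f L.
Hypothesis m_gt0 : 0 < m.
Implicit Types x u : 'rV[R]_n.

Lemma err_quantityE {d dX} {T : measurableType d} {X : measurableType dX}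
    (nu : 'rV[R]_n -> X -> R) (U : T -> 'rV[R]_n) (Xi1 Xi2 : T -> X) x w :
  err_quantity f nu U Xi1 Xi2 x m w =
  dotv (U w) (U w) / m ^+ 2 *
    (taylor_remainder f x (m *: U w) + nu (x + m *: U w) (Xi1 w) - nu x (Xi2 w)) ^+ 2.
Proof.
rewrite /err_quantity -scalerBl sqr_enorm /taylor_remainder dotvZl !dotvZr.
by field; rewrite gt_eqF.
Qed.

Lemma weighted_remainder_le (v : R) x u :
  dotv u u / m ^+ 2 * (taylor_remainder f x (m *: u) ^+ 2 + v) <=
  L ^+ 2 * m ^+ 2 / 4 * dotv u u ^+ 3 + v / m ^+ 2 * dotv u u.
Proof.
set s := dotv u u; have s0 : 0 <= s by exact: dotv_ge0.
have remainder_le : taylor_remainder f x (m *: u) ^+ 2 <= (L / 2 * (m ^+ 2 * s)) ^+ 2.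
  have := lipschitz_grad_remainder x (m *: u) df f_lip.
  rewrite dotvZl dotvZr (mulrA m) -expr2 -/s => rem_le.
  rewrite -(real_normK (num_real (taylor_remainder _ _ _))) ler_sqr ?nnegrE//.
  exact: le_trans rem_le.
have -> : L ^+ 2 * m ^+ 2 / 4 * s ^+ 3 + v / m ^+ 2 * s =
    s / m ^+ 2 * ((L / 2 * (m ^+ 2 * s)) ^+ 2 + v).
  by field; rewrite gt_eqF.
by rewrite ler_wpM2l ?lerD2r// divr_ge0// sqr_ge0.
Qed.

Context {d dX : measure_display} {T : measurableType d} {X : measurableType dX}
  (P : probability T R) (nu : 'rV[R]_n -> X -> R) (v1 v2 : R)
  (U : T -> 'rV[R]_n) (Xi1 Xi2 : T -> X) (x : 'rV[R]_n).
Hypothesis mnu :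
  measurable_fun setT (fun p : n.-tuple R * X => nu (rv_of_tuple p.1) p.2).
Hypothesis mU : measurable_coords U.
Hypotheses (mXi1 : measurable_fun setT Xi1) (mXi2 : measurable_fun setT Xi2).
Hypothesis noise1 : forall y, centered_noise P v1 (fun w => nu y (Xi1 w)).
Hypothesis noise2 : forall y, centered_noise P v2 (fun w => nu y (Xi2 w)).
Hypothesis indep : mutually_indep P (fun i w => U w ord0 i) Xi1 Xi2.

Lemma mean_err_quantity :
  (\int[P]_w (err_quantity f nu U Xi1 Xi2 x m w)%:E =
   \int[P]_w (dotv (U w) (U w) / m ^+ 2 *
     (taylor_remainder f x (m *: U w) ^+ 2 + (v1 + v2)))%:E)%E.
Proof.
pose V w := tuple_of_rv (U w).
have VK w : rv_of_tuple (V w) = U w by exact: tuple_of_rvK.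
have mrv := @measurable_coords_rv_of_tuple R n.
have mrv_fst : measurable_coords (fun p : n.-tuple R * X => rv_of_tuple p.1).
  by move=> i; exact: measurableT_comp (mrv i) measurable_fst.
pose weight (t : n.-tuple R) := dotv (rv_of_tuple t) (rv_of_tuple t) / m ^+ 2.
pose drift (t : n.-tuple R) := taylor_remainder f x (m *: rv_of_tuple t).
pose N1 (t : n.-tuple R) := nu (x + m *: rv_of_tuple t).
have mweight : measurable_fun setT weight.
  by apply: measurable_funM => //; exact: measurable_dotv.
have weight0 t : 0 <= weight t by rewrite divr_ge0 ?dotv_ge0 ?sqr_ge0.
have mdrift : measurable_fun setT drift.
  by apply: measurable_taylor_remainder => //; exact: measurable_coordsZ.
have mN1 : measurable_fun setT (fun p : n.-tuple R * X => N1 p.1 p.2).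
  apply: (measurable_noise mnu) => //.
  by apply: measurable_coordsDl; exact: measurable_coordsZ.
have mN2 : measurable_fun setT (fun p : n.-tuple R * X => nu x p.2).
  by apply: (measurable_noise mnu) => // i; exact: measurable_cst.
have := integral_weighted_sqr_noise (N1 := N1) (N2 := fun=> nu x)
  (measurable_mktuple mU) mXi1 mXi2 (mutually_indep_coords_noise indep mU mXi1 mXi2)
  (mutually_indep_noise indep) mweight weight0 mdrift mN1 mN2
  (fun=> noise1 _) (fun=> noise2 x).
rewrite -/V => weighted.
transitivity (\int[P]_w (weight (V w) *
    (drift (V w) + N1 (V w) (Xi1 w) - nu x (Xi2 w)) ^+ 2)%:E)%E.
  by apply: eq_integral => w _; rewrite err_quantityE /weight /drift /N1 VK.
rewrite weighted.
by apply: eq_integral => w _; rewrite /weight /drift VK.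
Qed.

Lemma mean_err_quantity_le :
  (forall i, standard_normal_rv P (fun w => U w ord0 i)) ->
  (\int[P]_w (err_quantity f nu U Xi1 Xi2 x m w)%:E <=
   (L ^+ 2 * m ^+ 2 / 4 * chi2_moment n%:R 3 + (v1 + v2) / m ^+ 2 * n%:R)%:E)%E.
Proof.
move=> U_normal; rewrite mean_err_quantity.
pose S w := dotv (U w) (U w).
have S0 w : 0 <= S w by exact: dotv_ge0.
have mS : measurable_fun setT S by exact: measurable_dotv.
have S_moments : has_chi2_moments P S n%:R.
  apply: (has_chi2_moments_sum mU (mutually_indep_coords indep)) => i.
  exact: standard_normal_has_chi2_moments (mU i) (U_normal i).
have mean_S : (\int[P]_w (S w)%:E = n%:R%:E)%E.
  have := S_moments 1; rewrite chi2_momentS /chi2_moment big_ord0 mul1r addr0 => <-.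
  by apply: eq_integral => w _; rewrite expr1.
have v_ge0 : 0 <= v1 + v2.
  exact: addr_ge0 (centered_noise_ge0 (noise1 x)) (centered_noise_ge0 (noise2 x)).
have a0 : 0 <= L ^+ 2 * m ^+ 2 / 4 by rewrite divr_ge0// mulr_ge0 ?sqr_ge0.
have b0 : 0 <= (v1 + v2) / m ^+ 2 by rewrite divr_ge0 ?sqr_ge0.
have mS3 : measurable_fun setT (fun w => S w ^+ 3) by exact: measurable_funX.
have S3_ge0 w : 0 <= S w ^+ 3 by rewrite exprn_ge0.
rewrite EFinD !EFinM -S_moments -mean_S -!EFinM -ge0_integral_lincomb//.
apply: ge0_le_integral => //.
- move=> w _; rewrite lee_fin mulr_ge0 ?divr_ge0 ?dotv_ge0 ?sqr_ge0//.
  by rewrite addr_ge0 ?sqr_ge0.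
- apply/measurable_EFinP; apply: measurable_funM; first exact: measurable_funM.
  apply: measurable_funD => //; apply: measurable_funX.
  by apply: measurable_taylor_remainder => //; exact: measurable_coordsZ.
- by apply/measurable_EFinP; apply: measurable_funD; exact: measurable_funM.
- by move=> w _; rewrite lee_fin weighted_remainder_le.
Qed.

End ForwardDifferenceError.

Lemma balanced_sum {R : rcfType} (a b m : R) :
  0 <= a -> 0 < m -> a * m ^+ 4 = b -> a * m ^+ 2 + b / m ^+ 2 = 2 * Num.sqrt (a * b).
Proof.
move=> a0 m0 <-; have -> : a * (a * m ^+ 4) = (a * m ^+ 2) ^+ 2 by ring.
have am0 : 0 <= a * m ^+ 2 by rewrite mulr_ge0 ?sqr_ge0.
rewrite sqrtr_sqr ger0_norm//.
by field; rewrite gt_eqF.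
Qed.

Lemma optimal_smoothing_error {R : realType} (n : nat) (L s m : R) :
  0 < L -> 0 < s -> 0 < m ->
  m ^+ 4 = 8 * s ^+ 2 * n%:R / (L ^+ 2 * (n%:R + 6) ^+ 3) ->
  L ^+ 2 * m ^+ 2 / 4 * chi2_moment n%:R 3 + (s ^+ 2 + s ^+ 2) / m ^+ 2 * n%:R <=
  Num.sqrt 2 * L * s * Num.sqrt (n%:R * (n%:R + 6) ^+ 3).
Proof.
move=> L0 s0 m0 mE; set B := (n%:R + 6) ^+ 3 in mE *.
have B0 : 0 < B by rewrite exprn_gt0// addr_gt0_wr.
pose a := L ^+ 2 * B / 4; pose b := 2 * s ^+ 2 * n%:R.
have a0 : 0 <= a by rewrite divr_ge0// mulr_ge0 ?sqr_ge0// ltW.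
have balance : a * m ^+ 4 = b by rewrite mE /a /b; field; rewrite !gt_eqF.
have -> : Num.sqrt 2 * L * s * Num.sqrt (n%:R * B) = 2 * Num.sqrt (a * b).
  have -> : a * b = 2 * (L * s / 2) ^+ 2 * (n%:R * B) by rewrite /a /b; field.
  have Ls0 : 0 <= L * s / 2 by rewrite divr_ge0// mulr_ge0 ?ltW.
  have sqr0 : 0 <= 2 * (L * s / 2) ^+ 2 by apply: mulr_ge0 => //; exact: sqr_ge0.
  rewrite (sqrtrM _ sqr0) (sqrtrM _ (ler0n R 2)) sqrtr_sqr (ger0_norm Ls0).
  by field.
rewrite -(balanced_sum a0 m0 balance).
have -> : a * m ^+ 2 + b / m ^+ 2 =
    L ^+ 2 * m ^+ 2 / 4 * B + (s ^+ 2 + s ^+ 2) / m ^+ 2 * n%:R.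
  by rewrite /a /b; field; rewrite gt_eqF.
rewrite lerD2r; apply: ler_wpM2l; last exact: chi2_moment_le.
by rewrite divr_ge0// mulr_ge0 ?sqr_ge0.
Qed.

Lemma powRV_expr {R : realType} (a : R) (k : nat) :
  0 <= a -> (0 < k)%N -> (a `^ k%:R^-1) ^+ k = a.
Proof.
move=> a0 k0; rewrite -powR_mulrn ?powR_ge0// -powRrM.
by rewrite mulVf ?powRr1// pnatr_eq0 -lt0n.
Qed.

Theorem theorem1 (R : realType) (n : nat)
  (f : 'rV[R]_n -> R) (L1 : R)
  (d dX : measure_display) (T : measurableType d) (X : measurableType dX)
  (P : probability T R)
  (nu : 'rV[R]_n -> X -> R) (sigma_a : R)
  (U : T -> 'rV[R]_n) (Xi1 Xi2 : T -> X) :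
  (* f convex, continuously differentiable, L1-Lipschitz gradient *)
  convex_fun f ->
  (forall x : 'rV[R]_n, differentiable f x) ->
  continuous (grad f) ->
  0 < L1 ->
  (forall x y : 'rV[R]_n, enorm (grad f x - grad f y) <= L1 * enorm (x - y)) ->
  (* noise: jointly measurable, mean 0, variance sigma_a^2 > 0 *)
  0 < sigma_a ->
  measurable_fun setT (fun p : n.-tuple R * X => nu (rv_of_tuple p.1) p.2) ->
  (* random elements *)
  (forall i : 'I_n, measurable_fun setT (fun w => U w ord0 i)) ->
  measurable_fun setT Xi1 -> measurable_fun setT Xi2 ->
  (* xi1, xi2 identically distributed *)
  (forall C : set X, measurable C -> P (Xi1 @^-1` C) = P (Xi2 @^-1` C)) ->
  (forall x : 'rV[R]_n,
     P.-integrable setT (fun w => (nu x (Xi1 w))%:E) /\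
     ('E_P[fun w => nu x (Xi1 w)] = 0)%E /\
     ('V_P[fun w => nu x (Xi1 w)] = (sigma_a ^+ 2)%:E)%E) ->
  (forall x : 'rV[R]_n,
     P.-integrable setT (fun w => (nu x (Xi2 w))%:E) /\
     ('E_P[fun w => nu x (Xi2 w)] = 0)%E /\
     ('V_P[fun w => nu x (Xi2 w)] = (sigma_a ^+ 2)%:E)%E) ->
  (* u standard Gaussian: i.i.d. N(0,1) coordinates; u, xi1, xi2 independent *)
  (forall (i : 'I_n) (B : set R), measurable B ->
     P ((fun w => U w ord0 i) @^-1` B) = normal_prob 0 1 B) ->
  mutually_indep P (fun i w => U w ord0 i) Xi1 Xi2 ->
  let mu_star :=
    (8 * sigma_a ^+ 2 * n%:R / (L1 ^+ 2 * (n%:R + 6) ^+ 3)) `^ (4%:R^-1) in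
  forall x : 'rV[R]_n,
    (\int[P]_w (err_quantity f nu U Xi1 Xi2 x mu_star w)%:E
       <= (Num.sqrt 2 * L1 * sigma_a * Num.sqrt (n%:R * (n%:R + 6) ^+ 3))%:E)%E.
Proof.
move=> _ df _ L0 f_lip s0 mnu mU mXi1 mXi2 _ noise1 noise2 U_normal indep mu_star x.
have [n0|n_gt0] := posnP n.
  rewrite integral0_eq ?lee_fin ?mulr_ge0 ?sqrtr_ge0 ?(ltW L0) ?(ltW s0)// => w _.
  by rewrite /err_quantity sqr_enorm dotv_dim0.
have ratio_gt0 : 0 < 8 * sigma_a ^+ 2 * n%:R / (L1 ^+ 2 * (n%:R + 6) ^+ 3).
  have n6_gt0 : 0 < n%:R + 6 :> R by rewrite addr_gt0// ltr0n.
  by rewrite divr_gt0 ?mulr_gt0 ?exprn_gt0 ?ltr0n.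
have mu_gt0 : 0 < mu_star by exact: powR_gt0.
have mean_le := mean_err_quantity_le (v1 := sigma_a ^+ 2) (v2 := sigma_a ^+ 2)
  df f_lip mu_gt0 x mnu mU mXi1 mXi2 noise1 noise2 indep U_normal.
apply: le_trans mean_le _; rewrite lee_fin optimal_smoothing_error//.
by rewrite powRV_expr// ltW.
Qed.
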